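(* Let $p\in\mathbb{Z}^n$ have positive components, $r\in\mathbb{Z}^n$, $M$ an integer, and let $a=pM+r$ have positive components. Let $u$ be a vector each of whose components is a positive integer or $+\infty$, let $\beta_1,\beta_2$ satisfy $0<\beta_1\le\beta_2<au$, and consider $$\text{(KP)}\quad \beta_1\le ax\le\beta_2,\ 0\le x\le u,\ x\in\mathbb{Z}^n,\qquad \text{(KP-R)}\quad \beta_1\le(aU)y\le\beta_2,\ 0\le Uy\le u,\ y\in\mathbb{Z}^n,$$ where $U$ is a unimodular matrix such that the columns of $AU$, $A=\begin{pmatrix}a\\ I_n\end{pmatrix}$, form a reduced basis computed by a basis reduction method with reduction factor $c_n$. Let $\tilde p=pU$. Then: 1. Let $1\le k\le n-1$ and suppose $M>c_n(\|r\|+1)^2\alpha_k$. Then $\tilde p_1=\dots=\tilde p_k=0$. Also, if the infeasibility of (KP) is proven by branching on $px$, then the infeasibility of (KP-R) is proven by branching on $y_{k+1},\dots,y_n$. 2. Suppose $M>c_n(\|r\|+1)^2\|p\|$. Then $\tilde p_1=\dots=\tilde p_{n-1}=0$, and $$\operatorname{width}(e_n,\text{(KP-R)})\le\operatorname{width}(p,\text{(KP)}),\qquad \operatorname{iwidth}(e_n,\text{(KP-R)})\le\operatorname{iwidth}(p,\text{(KP)}).$$ In particular, if $p$ and $r$ are not parallel and $r_1/p_1\le\dots\le r_n/p_n$, then in the rangespace reformulation of $\text{(KP-EQ)}$: $ax=\beta$, $x\ge0$, $x\in\mathbb{Z}^n$ (i.e. in (KP-R) with $\beta_1=\beta_2=\beta$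 and all $u_i=+\infty$) the width and the integer width in the direction of $e_n$ are $\Theta(\beta/M^2)$.
   Context: $\|\cdot\|$ is the Euclidean norm; $px$, $ax$, $au$ are inner products ($au=+\infty$ if some $u_i=+\infty$); $e_n$ is the $n$th unit vector. Unimodular means integral with determinant $\pm1$. The LP relaxation is obtained by dropping integrality. $\alpha_k=\Lambda_k(\{v\in\mathbb{Z}^n : pv=0\})$ for $k=1,\dots,n-1$, where for a lattice $L$, $\Lambda_k(L)$ is the smallest $t$ such that $L$ contains $k$ linearly independent vectors of norm at most $t$. Reduction factor: a basis reduction method has reduction factor $c_n$ (a constant depending only on $n$) if for every lattice of rank $n$ and every reduced basis $b_1,\dots,b_n$ of it, $$\max\{\|b_1\|,\dots,\|b_i\|\}\le c_n\max\{\|d_1\|,\dots,\|d_i\|\}$$ for all $i\le n$ and all linearly independent $d_1,\dots,d_i$ in the lattice. The infeasibility of an integer program is proven by branching on $px$ if $px$ is nonintegral for all $x$ in its LP relaxation; it is proven by branching on $y_{k+1},\dots,y_n$ if no $y$ in its LP relaxation has all of $y_{k+1},\dots,y_n$ integral. For a polyhedron $Q$ and integral $c$, $\operatorname{width}(c,Q)=\max_{x\in Q}cx-\min_{x\in Q}cx$ and $\operatorname{iwidth}(c,Q)=\lfloor\max_{x\in Q}cx\rfloor-\lceil\min_{x\in Q}cx\rceil+1$; for an integer program (P), $\operatorname{width}(c,\text{(P)})$ and $\operatorname{iwidth}(c,\text{(P)})$ refer to its LP relaxation. $\Theta(\beta/M^2)$ means bounded below and above by positive constant multiples of $\beta/M^2$,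 where the constants depend on $p$ and $r$.
   Formalization: The integer width is claimed to be Θ(β/M²) only when β/M² is at least a threshold depending on p and r; without it the claim fails, e.g. p=(1,1), r=(0,1), β=M gives integer width 1 while β/M²=1/M. *)

(* Defs.v *)
From mathcomp Require Import all_boot all_order all_algebra.
From mathcomp Require Import all_classical all_reals.

Set Implicit Arguments.
Unset Strict Implicit.
Unset Printing Implicit Defensive.

Import Order.TTheory GRing.Theory Num.Theory.

Local Open Scope classical_set_scope.
Local Open Scope ring_scope.

Section Definitions.
Variable R : realType.

Definition toR m n (A : 'M[int]_(m, n)) : 'M[R]_(m, n) := map_mx intr A.

Definition dot n (c : 'rV[int]_n) (x : 'cV[R]_n) : R := (toR c *m x) 0 0.

(* Euclidean norm, applied below to row and to column vectors only. *)
Definition enorm m n (v : 'M[R]_(m, n)) : R :=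
  Num.sqrt (\sum_i \sum_j v i j ^+ 2).

Definition unimodular n (U : 'M[int]_n) : Prop := \det U = 1 \/ \det U = -1.

Definition parallel n (v w : 'rV[int]_n) : Prop :=
  exists t : R, toR v = t *: toR w \/ toR w = t *: toR v.

Definition lin_indep m k (D : 'M[R]_(m, k)) : Prop := \rank D = k.

(* The lattice generated by the columns of B. *)
Definition lattice m n (B : 'M[R]_(m, n)) : set 'cV[R]_m :=
  [set v | exists z : 'cV[int]_n, v = B *m toR z].

(* k-th successive minimum; a lattice is discrete, so for k at most its rank
   the infimum is attained. *)
Definition Lambda m (k : nat) (L : set 'cV[R]_m) : R :=
  inf [set t : R | exists D : 'M[R]_(m, k),
    lin_indep D /\ forall j, L (col j D) /\ enorm (col j D) <= t].

Definition alpha n (p : 'rV[int]_n) (k : nat) : R :=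
  Lambda k [set v | exists2 z : 'cV[int]_n, p *m z = 0 & v = toR z].

(* A basis reduction method enters only through the bases (given as the
   columns of a matrix, in any ambient dimension m and of any rank n) that it
   regards as reduced. *)
Definition reduction_method := forall m n : nat, 'M[R]_(m, n) -> Prop.

Definition has_reduction_factor (reduced : reduction_method) (n : nat) (c : R)
    : Prop :=
  forall (m : nat) (B : 'M[R]_(m, n)), lin_indep B -> reduced m n B ->
  forall (i : nat) (D : 'M[R]_(m, i)), (i <= n)%N ->
    lin_indep D -> (forall j, lattice B (col j D)) ->
    \big[Num.max/0]_(j < n | (j < i)%N) enorm (col j B)
      <= c * \big[Num.max/0]_(j < i) enorm (col j D).

(* LP relaxations of (KP) and of its rangespace reformulation (KP-R); upper
   bounds on the variables are extended reals, +oo meaning no bound. *)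
Definition KP n (a : 'rV[int]_n) (u : 'I_n -> \bar R) (b1 b2 : R)
    : set 'cV[R]_n :=
  [set x | b1 <= dot a x <= b2 /\
           forall i, 0 <= x i 0 /\ ((x i 0)%:E <= u i)%E].

Definition KPR n (a : 'rV[int]_n) (U : 'M[int]_n) (u : 'I_n -> \bar R)
    (b1 b2 : R) : set 'cV[R]_n :=
  [set y | b1 <= dot (a *m U) y <= b2 /\
           forall i, 0 <= (toR U *m y) i 0 /\
                     (((toR U *m y) i 0)%:E <= u i)%E].

(* Here and below Q is the LP relaxation of an integer program. *)
Definition infeasible_by_branching_on n (p : 'rV[int]_n) (Q : set 'cV[R]_n)
    : Prop :=
  forall x, Q x -> dot p x \isn't a Num.int.

(* Branching on y_{k+1}, ..., y_n, whose 0-based indices are k, ..., n-1. *)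
Definition infeasible_by_branching_from n (k : nat) (Q : set 'cV[R]_n)
    : Prop :=
  ~ exists y, Q y /\ forall j : 'I_n, (k <= j)%N -> y j 0 \is a Num.int.

(* sup and inf are the max and min over Q when Q is nonempty and compact,
   as are KP a u b1 b2 and KPR a U u b1 b2 when a is positive, U unimodular
   and 0 < b1 <= b2 < a u. *)
Definition maxdot n (c : 'rV[int]_n) (Q : set 'cV[R]_n) : R := sup (dot c @` Q).
Definition mindot n (c : 'rV[int]_n) (Q : set 'cV[R]_n) : R := inf (dot c @` Q).

Definition width n (c : 'rV[int]_n) (Q : set 'cV[R]_n) : R :=
  maxdot c Q - mindot c Q.

Definition iwidth n (c : 'rV[int]_n) (Q : set 'cV[R]_n) : int :=
  Num.floor (maxdot c Q) - Num.ceil (mindot c Q) + 1.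

End Definitions.

Arguments toR R {m n} A.
Arguments parallel R {n} v w.
Arguments alpha R {n} p k.

Definition e_last n : 'rV[int]_n := \row_(j < n) (j.+1 == n)%:R.

(* Main.v *)
Require Import Defs.
From mathcomp Require Import all_boot all_order all_algebra all_fingroup.
From mathcomp Require Import all_classical all_reals.
From mathcomp Require Import ring lra.

(** Write [A] for [col_mx a 1%:M] with [a = M *: p + r]. The proof plays two
    estimates on the length of [A d], for [d] integral, against each other.

    If [p d = 0], the large multiple [M p] disappears from [a d = r d], so
    [A d] is at most [(|r| + 1) |d|] long ([enorm_stack_le]). If [p d] is
    nonzero it is at least 1 in absolute value, so [M] is at most
    [|a d| + |r| |d|], hence at most [(|r| + 1) |A d|] ([le_enorm_stack]).
    Given [k] independent vectors orthogonal to [p] of length at most [t], the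
    lattice generated by [A U] contains [k] independent vectors of length at
    most [(|r| + 1) t], so its first [k] reduced basis vectors, the
    [A U_j], have length at most [c (|r| + 1) t]. When [M] exceeds
    [c (|r| + 1)^2 t], the second case is ruled out for these columns, that
    is [(p U)_j = 0] ([pU_eq0_of_short_vectors]). Taking [t] close to
    [alpha_k] gives part 1. For part 2, the vectors [p_n e_i - p_i e_n]
    provide [n - 1] independent integral solutions of [p x = 0] which are at
    most as long as [p] ([orthogonal_vectors]).

    Substituting [x = U y] turns [p x] into [(p U) y]. If the first [k]
    entries of [p U] vanish, integral values of [y_{k+1}, ..., y_n] make [p x]
    integral, whence the statement on branching. If only the last entry [q]
    survives, [p x = q y_n], so that the set of values of [p x] over (KP) is
    [q] times the set of values of [y_n] over (KP-R), and [q] is a nonzero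
    integer: this compares widths and integer widths ([width_scale]).

    For the asymptotics, the values of [p x] on the simplex [a x = b], [x >= 0]
    fill the interval between [b] times the extreme ratios
    [p_i / a_i = 1 / (M + r_i / p_i)] ([width_KP_EQ]). The difference of the
    two extremes is [b (r_n/p_n - r_1/p_1)] divided by a product of two factors
    lying between [M / 2] and [2 M] ([width_Theta]). Since [q] divides every
    [p_i], it lies between 1 and [p_1] in absolute value, so dividing by it
    keeps the order of magnitude. The integer width differs from the width by
    at most 1, which is absorbed once [b / M^2] is large. *)

Set Implicit Arguments.
Unset Strict Implicit.
Unset Printing Implicit Defensive.

Import Order.TTheory GRing.Theory Num.Theory.
Local Open Scope classical_set_scope.
Local Open Scope ring_scope.

(** * Inner products and Euclidean norms *)

Lemma toR_mulmx (R : realType) m n k (A : 'M[int]_(m, n)) (B : 'M[int]_(n, k)) :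
  toR R (A *m B) = toR R A *m toR R B.
Proof. exact: map_mxM. Qed.

Lemma dotE (R : realType) n (c : 'rV[int]_n) (x : 'cV[R]_n) :
  dot c x = \sum_i (c 0 i)%:~R * x i 0.
Proof. by rewrite /dot mxE; apply: eq_bigr => i _; rewrite mxE. Qed.

Lemma dot_toR (R : realType) n (c : 'rV[int]_n) (d : 'cV[int]_n) :
  dot c (toR R d) = ((c *m d) 0 0)%:~R.
Proof. by rewrite /dot -toR_mulmx mxE. Qed.

Lemma dotDl (R : realType) n (c d : 'rV[int]_n) (x : 'cV[R]_n) :
  dot (c + d) x = dot c x + dot d x.
Proof.
by rewrite !dotE -big_split; apply: eq_bigr => i _; rewrite mxE rmorphD mulrDl.
Qed.

Lemma dotZl (R : realType) n (M : int) (c : 'rV[int]_n) (x : 'cV[R]_n) :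
  dot (M *: c) x = M%:~R * dot c x.
Proof.
by rewrite !dotE mulr_sumr; apply: eq_bigr => i _; rewrite mxE rmorphM mulrA.
Qed.

Lemma dot_mulmx (R : realType) n (c : 'rV[int]_n) (U : 'M[int]_n)
    (y : 'cV[R]_n) : dot (c *m U) y = dot c (toR R U *m y).
Proof. by rewrite /dot toR_mulmx mulmxA. Qed.

Lemma enorm_ge0 (R : realType) m n (v : 'M[R]_(m, n)) : 0 <= enorm v.
Proof. exact: sqrtr_ge0. Qed.

Lemma sqr_enorm (R : realType) m n (v : 'M[R]_(m, n)) :
  enorm v ^+ 2 = \sum_i \sum_j v i j ^+ 2.
Proof.
by rewrite sqr_sqrtr//; apply: sumr_ge0 => i _; apply: sumr_ge0 => j _; exact: sqr_ge0.
Qed.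

Lemma sqr_enorm_row (R : realType) n (v : 'rV[R]_n) :
  enorm v ^+ 2 = \sum_j v 0 j ^+ 2.
Proof. by rewrite sqr_enorm big_ord1. Qed.

Lemma sqr_enorm_col (R : realType) n (v : 'cV[R]_n) :
  enorm v ^+ 2 = \sum_i v i 0 ^+ 2.
Proof. by rewrite sqr_enorm; apply: eq_bigr => i _; rewrite big_ord1. Qed.

Lemma norm_le_enorm (R : realType) m n (v : 'M[R]_(m, n)) i j :
  `|v i j| <= enorm v.
Proof.
rewrite -(ler_pXn2r (n := 2)) ?nnegrE ?enorm_ge0// sqr_enorm.
rewrite real_normK ?num_real// (bigD1 i)//= (bigD1 j)//= -addrA lerDl addr_ge0//.
  by apply: sumr_ge0 => l _; exact: sqr_ge0.
by apply: sumr_ge0 => k _; apply: sumr_ge0 => l _; exact: sqr_ge0.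
Qed.

(** The Cauchy-Schwarz inequality for finite families. *)
Lemma sqr_sumM_le (R : realType) (I : finType) (x y : I -> R) :
  (\sum_i x i * y i) ^+ 2 <= (\sum_i x i ^+ 2) * (\sum_i y i ^+ 2).
Proof.
set X := \sum_i x i ^+ 2; set Y := \sum_i y i ^+ 2; set S := \sum_i x i * y i.
have X0 : 0 <= X by apply: sumr_ge0 => i _; exact: sqr_ge0.
(* The discriminant of the nonnegative quadratic form |s x + t y|^2. *)
have quad s t : 0 <= s ^+ 2 * X + 2 * s * t * S + t ^+ 2 * Y.
  rewrite !mulr_sumr -!big_split; apply: sumr_ge0 => i _ /=.
  by have := sqr_ge0 (s * x i + t * y i); nra.
have Y0 : 0 <= Y by apply: sumr_ge0 => i _; exact: sqr_ge0.
have [X_gt0|X_le0] := ltrP 0 X; first by have := quad (- S) X; nra.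
have [Y_gt0|Y_le0] := ltrP 0 Y; first by have := quad Y (- S); nra.
by have := quad 1 (- S); nra.
Qed.

Lemma norm_dot_le (R : realType) n (c : 'rV[int]_n) (x : 'cV[R]_n) :
  `|dot c x| <= enorm (toR R c) * enorm x.
Proof.
rewrite -(ler_pXn2r (n := 2)) ?nnegrE ?mulr_ge0 ?enorm_ge0// exprMn.
rewrite real_normK ?num_real// dotE sqr_enorm_row sqr_enorm_col.
under [X in _ <= X * _]eq_bigr => i _ do rewrite mxE.
exact: sqr_sumM_le.
Qed.

(** * The length of the lattice vectors [(a d; d)] *)

Lemma sqr_enorm_stack (R : realType) n (a : 'rV[int]_n) (d : 'cV[int]_n) :
  enorm (toR R (col_mx a 1%:M *m d)) ^+ 2 =
  dot a (toR R d) ^+ 2 + enorm (toR R d) ^+ 2.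
Proof.
rewrite mul_col_mx mul1mx !sqr_enorm_col big_split_ord/= big_ord1.
congr (_ + _); first by rewrite mxE col_mxEu dot_toR.
by apply: eq_bigr => i _; rewrite mxE col_mxEd mxE.
Qed.

(** When [p d = 0] the length does not depend on [M], because
    [(M p + r) d = r d]. *)
Lemma enorm_stack_le (R : realType) n (p r : 'rV[int]_n) (M : int)
    (d : 'cV[int]_n) : p *m d = 0 ->
  enorm (toR R (col_mx (M *: p + r) 1%:M *m d)) <=
  (enorm (toR R r) + 1) * enorm (toR R d).
Proof.
move=> pd0.
have E0 := enorm_ge0 (toR R r); have F0 := enorm_ge0 (toR R d).
rewrite -(ler_pXn2r (n := 2)) ?nnegrE ?mulr_ge0 ?enorm_ge0 ?addr_ge0//.
rewrite sqr_enorm_stack dotDl dotZl !dot_toR pd0 mxE mulr0 add0r -dot_toR.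
have CS : dot r (toR R d) ^+ 2 <= (enorm (toR R r) * enorm (toR R d)) ^+ 2.
  rewrite -[X in X <= _]real_normK ?num_real// ler_pXn2r ?nnegrE ?mulr_ge0//.
  exact: norm_dot_le.
by have := mulr_ge0 E0 (sqr_ge0 (enorm (toR R d))); nra.
Qed.

(** When the integer [p d] is nonzero, [M <= |M (p d)| = |a d - r d|], and
    both [a d] and [d] are parts of the stacked vector. *)
Lemma le_enorm_stack (R : realType) n (p r : 'rV[int]_n) (M : int)
    (d : 'cV[int]_n) : (p *m d) 0 0 != 0 ->
  M%:~R <= (enorm (toR R r) + 1) * enorm (toR R (col_mx (M *: p + r) 1%:M *m d)).
Proof.
move=> pd_neq0; set a := M *: p + r; set N := enorm (toR R (_ *m _)).
have r0 := enorm_ge0 (toR R r); have N0 : 0 <= N := enorm_ge0 _.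
have N2 : N ^+ 2 = dot a (toR R d) ^+ 2 + enorm (toR R d) ^+ 2.
  exact: sqr_enorm_stack.
have leN (x : R) : x ^+ 2 <= N ^+ 2 -> `|x| <= N.
  by rewrite -[x ^+ 2]real_normK ?num_real// ler_pXn2r ?nnegrE.
have ad : `|dot a (toR R d)| <= N by apply: leN; rewrite N2 lerDl sqr_ge0.
have dN : enorm (toR R d) <= N.
  by rewrite -[X in X <= _]ger0_norm ?enorm_ge0// leN// N2 lerDr sqr_ge0.
have MN : `|M%:~R * dot p (toR R d)| <= N + enorm (toR R r) * N.
  have -> : M%:~R * dot p (toR R d) = dot a (toR R d) - dot r (toR R d).
    by rewrite dotDl dotZl addrK.
  apply: le_trans (ler_normB _ _) _; apply: lerD => //.
  by apply: le_trans (norm_dot_le _ _) _; apply: ler_wpM2l.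
rewrite mulrDl mul1r addrC; apply: le_trans MN.
rewrite normrM; apply: le_trans (ler_norm _) _; rewrite ler_peMr//.
by rewrite dot_toR -intr_norm -[1]/(1%:~R) ler_int -gtz0_ge1 normr_gt0.
Qed.

(** * Short kernel vectors of [p] and the reduced basis *)

Lemma unimodular_unitmx n (U : 'M[int]_n) : unimodular U -> U \in unitmx.
Proof. by rewrite unitmxE => -[] ->. Qed.

(** The left inverse is only asked up to a scalar, so that integral matrices
    such as the one of [orthogonal_vectors] need no division. *)
Lemma lin_indep_linv (R : realType) m n (L : 'M[R]_(n, m)) (B : 'M[R]_(m, n)) s :
  s != 0 -> L *m B = s%:M -> lin_indep B.
Proof.
move=> s0 LB; apply/eqP; rewrite eqn_leq rank_leq_col/=.
have LB_rank : \rank (L *m B) = n by rewrite LB -scalemx1 mxrank_scale_nz// mxrank1.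
by rewrite -[X in (X <= _)%N]LB_rank mxrankM_maxr.
Qed.

Lemma lin_indep_stackU (R : realType) n (a : 'rV[int]_n) (U : 'M[int]_n) :
  unimodular U -> lin_indep (toR R (col_mx a 1%:M *m U)).
Proof.
move=> /unimodular_unitmx U_unit.
apply: (@lin_indep_linv _ _ _ (toR R (invmx U *m row_mx 0 1%:M)) _ 1).
  exact: oner_neq0.
rewrite -toR_mulmx mulmxA -(mulmxA (invmx U)) mul_row_col mul0mx add0r.
by rewrite !mulmx1 mulVmx// /toR map_mx1.
Qed.

(** A basis may be compared with itself. This gives the positivity of [c] in
    the main estimates, and the lower bound on [M] behind the asymptotics. *)
Lemma reduction_factor_ge1 (R : realType) (reduced : reduction_method R) m n c
    (B : 'M[R]_(m, n)) : has_reduction_factor reduced n c ->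
  lin_indep B -> reduced m n B -> (0 < n)%N -> 1 <= c.
Proof.
move=> red_c B_indep B_red n_gt0.
have BB j : lattice B (col j B).
  by exists (delta_mx j 0); rewrite /toR map_delta_mx -colE.
have := red_c m B B_indep B_red n B (leqnn n) B_indep BB.
under [X in X <= _]eq_bigl => j do rewrite ltn_ord.
set N := \big[_/_]_(_ < _) _ => leN.
have N_gt0 : 0 < N.
  rewrite lt_neqAle eq_sym; apply/andP; split; last first.
    rewrite /N; elim/big_ind: _ => // [x y x0 y0|j _]; last exact: enorm_ge0.
    by rewrite le_max x0.
  apply/eqP => N0; have : \rank B = n := B_indep.
  suff -> : B = 0 by rewrite mxrank0 => n0; rewrite -n0 in n_gt0.
  apply/matrixP => i j; rewrite [RHS]mxE; apply/eqP; rewrite -normr_le0.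
  have -> : B i j = col j B i 0 by rewrite mxE.
  by rewrite -N0 (le_trans (norm_le_enorm _ _ _))// /N le_bigmax.
by rewrite -(ler_pM2r N_gt0) mul1r.
Qed.

(** The matrix [D] is a parameter because it is used both with near-minimal
    vectors for [alpha] and with the explicit vectors of length at most
    [|p|]. *)
Lemma pU_eq0_of_short_vectors (R : realType) (reduced : reduction_method R) (c : R) n k
    (p r : 'rV[int]_n) (M : int) (U : 'M[int]_n) (D : 'M[int]_(n, k)) (t : R) :
  let a := M *: p + r in
  has_reduction_factor reduced n c -> unimodular U ->
  reduced (1 + n)%N n (toR R (col_mx a 1%:M *m U)) -> (k <= n)%N ->
  lin_indep (toR R D) -> p *m D = 0 ->
  (forall j, enorm (toR R (col j D)) <= t) ->
  c * (enorm (toR R r) + 1) ^+ 2 * t < M%:~R ->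
  forall j : 'I_n, (j < k)%N -> (p *m U) 0 j = 0.
Proof.
move=> a red_c U_uni B_red k_le_n D_indep pD0 D_le t_lt j j_lt_k.
set B := toR R _ in B_red.
have B_indep : lin_indep B by exact: lin_indep_stackU.
have c_ge1 : 1 <= c.
  by apply: reduction_factor_ge1 red_c B_indep B_red _; case: j {j_lt_k} => ? /ltn_predK <-.
have t_ge0 : 0 <= t := le_trans (enorm_ge0 _) (D_le (Ordinal j_lt_k)).
have r0 := enorm_ge0 (toR R r).
set AD := toR R (col_mx a 1%:M *m D).
have colAD i : col i AD = toR R (col_mx a 1%:M *m col i D).
  by rewrite -map_col colE -mulmxA -colE.
have AD_indep : lin_indep AD.
  apply/eqP; rewrite eqn_leq rank_leq_col/= -[X in (X <= _)%N]D_indep.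
  have -> : toR R D = toR R (row_mx 0 1%:M) *m AD.
    by rewrite -toR_mulmx mulmxA mul_row_col mul0mx add0r !mul1mx.
  exact: mxrankM_maxr.
have AD_lat i : lattice B (col i AD).
  exists (invmx U *m col i D); rewrite colAD -toR_mulmx.
  by rewrite mulmxA mulmxK// unimodular_unitmx.
have AD_le i : enorm (col i AD) <= (enorm (toR R r) + 1) * t.
  rewrite colAD; apply: le_trans (enorm_stack_le R r M _) _.
    by rewrite colE mulmxA pD0 mul0mx.
  by rewrite ler_wpM2l ?addr_ge0.
have bj_le : enorm (col j B) <= c * ((enorm (toR R r) + 1) * t).
  apply: (le_trans _ (le_trans (red_c _ _ B_indep B_red _ _ k_le_n AD_indep AD_lat) _)).
    by apply: (le_bigmax_cond _ (fun i => enorm (col i B))).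
  rewrite ler_wpM2l ?(le_trans ler01)//; apply: bigmax_le => //.
  by rewrite mulr_ge0 ?addr_ge0.
have colB : col j B = toR R (col_mx a 1%:M *m col j U).
  by rewrite -map_col colE -mulmxA -colE.
apply/eqP; apply: contraTT t_lt => pUj; rewrite -leNgt.
apply: le_trans (@le_enorm_stack R n p r M (col j U) _) _.
  by rewrite colE mulmxA -colE mxE.
rewrite -/a -colB; have -> : c * (enorm (toR R r) + 1) ^+ 2 * t =
  (enorm (toR R r) + 1) * (c * ((enorm (toR R r) + 1) * t)) by ring.
by rewrite ler_wpM2l ?addr_ge0.
Qed.

(** The witnesses are [p_n e_j - p_j e_n] for [j < k]. They are independent
    because their first [k] coordinates form [p_n] times the identity, and
    short because the absolute values of their entries are dominated by those
    of [p] after exchanging the entries [j] and [n]. *)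
Lemma orthogonal_vectors (R : realType) n (p : 'rV[int]_n) k :
  (forall i, 0 < p 0 i) -> (k <= n - 1)%N ->
  exists D : 'M[int]_(n, k), [/\ lin_indep (toR R D), p *m D = 0 &
    forall j, enorm (toR R (col j D)) <= enorm (toR R p)].
Proof.
case: n p => [|m] p p_gt0.
  rewrite leqn0 => /eqP ->; exists 0; split=> [||[]//].
  - by rewrite /lin_indep; apply/eqP; rewrite -leqn0 rank_leq_col.
  - by rewrite mulmx0.
rewrite subn1/= => k_le_m.
have k_lt i : (i < k)%N -> (i < m.+1)%N by move=> /leq_trans; apply; exact: leqW.
pose w (j : 'I_k) : 'I_m.+1 := Ordinal (k_lt j (ltn_ord j)).
have w_max j : (w j == ord_max) = false.
  by apply/negbTE; rewrite -val_eqE/= neq_ltn (leq_trans (ltn_ord j)).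
pose D : 'M[int]_(m.+1, k) :=
  \matrix_(i, j) (p 0 ord_max *+ (i == w j) - p 0 (w j) *+ (i == ord_max)).
exists D; split.
- pose L : 'M[R]_(k, m.+1) := \matrix_(j, i) (i == w j)%:R.
  apply: (@lin_indep_linv _ _ _ L _ (p 0 ord_max)%:~R).
    by rewrite intr_eq0 gt_eqF.
  apply/matrixP => i j; rewrite !mxE (bigD1 (w i))//= big1 => [|l /negbTE li].
    rewrite !mxE eqxx mul1r addr0 w_max mulr0n subr0 rmorphMn/=.
    by rewrite -val_eqE.
  by rewrite !mxE li mul0r.
- apply/rowP => j; rewrite !mxE (bigD1 (w j))//= (bigD1 ord_max)/=; last first.
    by rewrite eq_sym w_max.
  rewrite big1 => [|l /andP[/negbTE lj /negbTE lm]]; last first.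
    by rewrite mxE lj lm !mulr0n subr0 mulr0.
  by rewrite !mxE !eqxx w_max eq_sym w_max !mulr0n !mulr1n; ring.
- move=> j; rewrite -(ler_pXn2r (n := 2)) ?nnegrE ?enorm_ge0//.
  rewrite sqr_enorm_row sqr_enorm_col.
  rewrite [X in _ <= X](reindex_inj (@perm_inj _ (tperm (w j) ord_max))).
  apply: ler_sum => l _; rewrite !mxE.
  case: tpermP => [->|->|/eqP/negbTE lj /eqP/negbTE lm].
  + by rewrite eqxx w_max mulr1n mulr0n subr0.
  + by rewrite eqxx eq_sym w_max mulr1n mulr0n sub0r rmorphN sqrrN.
  + by rewrite lj lm !mulr0n subr0 expr0n sqr_ge0.
Qed.

(** [alpha] is an infimum, so its vectors are only obtained up to an
    arbitrarily small excess of length. The infimum is that of a nonempty set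
    by [orthogonal_vectors]; otherwise it would have the default value 0. *)
Lemma alpha_lt (R : realType) n (p : 'rV[int]_n) k (x : R) :
  (forall i, 0 < p 0 i) -> (k <= n - 1)%N -> alpha R p k < x ->
  exists (D : 'M[int]_(n, k)) (t : R), [/\ lin_indep (toR R D), p *m D = 0,
    forall j, enorm (toR R (col j D)) <= t & t < x].
Proof.
move=> p_gt0 kn /inf_lt[].
  have [D [D_indep pD0 D_le]] := orthogonal_vectors R p_gt0 kn.
  exists (enorm (toR R p)), (toR R D); split=> // j; split.
    exists (col j D); first by rewrite colE mulmxA pD0 mul0mx.
    by rewrite /toR map_col.
  by have := D_le j; rewrite /toR map_col.
move=> t [D [D_indep D_lat]] t_lt.
have /choice[z zP] j : exists z : 'cV[int]_n, p *m z = 0 /\ col j D = toR R z.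
  by have [[z pz0 ->] _] := D_lat j; exists z.
pose Z : 'M[int]_(n, k) := \matrix_(i, j) z j i 0.
have colZ j : col j Z = z j by apply/colP => i; rewrite !mxE.
exists Z, t; split=> //.
- suff -> : toR R Z = D by [].
  apply/matrixP => i j; have [_ /colP/(_ i)] := zP j.
  by rewrite !mxE => ->.
- apply/row_matrixP => i; apply/rowP => j.
  have [/rowP/(_ 0)] := zP j; rewrite !mxE => pzj _.
  by rewrite -{}[RHS]pzj ord1; apply: eq_bigr => l _; rewrite !mxE.
- by move=> j; rewrite colZ; have [_ <-] := zP j; have [_] := D_lat j.
Qed.

(** * Widths of images under multiplication by an integer *)

Lemma supN (R : realType) (S : set R) : sup [set - t | t in S] = - inf S.
Proof. by rewrite /inf opprK. Qed.

Lemma infN (R : realType) (S : set R) : inf [set - t | t in S] = - sup S.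
Proof.
rewrite /inf image_comp; congr (- sup _).
by rewrite (_ : _ \o _ = id) ?image_id//; apply/funext => t /=; rewrite opprK.
Qed.

(** [S] and [q S] have a supremum together; when they have none, both sides
    are the default value 0. *)
Lemma sup_scale (R : realType) (q : R) (S : set R) : 0 < q ->
  sup [set q * t | t in S] = q * sup S.
Proof.
(* One inequality; the other one is the same fact for [q^-1] and [q S]. *)
have half (s : R) (T : set R) : 0 < s -> has_sup T ->
    has_sup [set s * t | t in T] /\ sup [set s * t | t in T] <= s * sup T.
  move=> s0 [T0 [y Ty]].
  have sT0 : [set s * t | t in T] !=set0 by case: T0 => t Tt; exists (s * t), t.
  have sTy : has_ubound [set s * t | t in T].
    by exists (s * y) => _ [t Tt <-]; rewrite ler_pM2l// Ty.
  split=> //; apply: ge_sup => // _ [t Tt <-].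
  by rewrite ler_pM2l// ub_le_sup//; exists y.
move=> q0; have qV0 : 0 < q^-1 by rewrite invr_gt0.
set T := image _ _.
have TK : [set q^-1 * t | t in T] = S.
  rewrite /T image_comp (_ : _ \o _ = id) ?image_id//.
  by apply/funext => t /=; rewrite mulKf ?gt_eqF.
have [S_sup|S_sup] := pselect (has_sup S); last first.
  rewrite !sup_out ?mulr0// => T_sup; apply: S_sup.
  by rewrite -TK; have [] := half _ _ qV0 T_sup.
have [T_sup leT] := half _ _ q0 S_sup; have [_] := half _ _ qV0 T_sup.
rewrite TK => leS; apply/eqP; rewrite eq_le leT/=.
by rewrite -ler_pdivlMl.
Qed.

Lemma inf_scale (R : realType) (q : R) (S : set R) : 0 < q ->
  inf [set q * t | t in S] = q * inf S.
Proof.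
move=> q0; rewrite /inf mulrN -sup_scale//; congr (- sup _).
by rewrite !image_comp; apply: eq_imagel => t _ /=; rewrite mulrN.
Qed.

Lemma sup_attained (R : realType) (S : set R) (m : R) :
  S m -> ubound S m -> sup S = m.
Proof.
move=> Sm Sub; apply/eqP; rewrite eq_le; apply/andP; split.
  by apply: ge_sup => //; exists m.
by apply: ub_le_sup => //; exists m.
Qed.

Lemma inf_attained (R : realType) (S : set R) (m : R) :
  S m -> lbound S m -> inf S = m.
Proof.
move=> Sm Slb; rewrite -[RHS]opprK; congr (- _); apply: sup_attained.
  by exists m.
by move=> _ [t St <-]; rewrite lerN2 Slb.
Qed.

(** If [[B, A]] contains an integer, multiplication by [q] stretches the span
    of its integers by the factor [q]. If not, the left-hand side is at most
    [-1], which no interval [[q B, q A]] can go below. *)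
Lemma floor_sub_ceil_scale (R : realType) (q : int) (A B : R) :
  1 <= q -> B <= A ->
  Num.floor A - Num.ceil B <= Num.floor (q%:~R * A) - Num.ceil (q%:~R * B).
Proof.
move=> q1 BA; have q0 : (0 : R) <= q%:~R by rewrite ler0z (le_trans ler01).
(* Does [[B, A]] contain an integer? *)
have [cf|fc] := lerP (Num.ceil B) (Num.floor A).
  have : q * Num.floor A <= Num.floor (q%:~R * A).
    by rewrite floor_ge_int rmorphM ler_wpM2l// floor_le.
  have : Num.ceil (q%:~R * B) <= q * Num.ceil B.
    by rewrite ceil_le_int rmorphM ler_wpM2l// ceil_ge.
  by nra.
have : Num.ceil (q%:~R * B) <= Num.floor (q%:~R * A) + 1.
  rewrite ceil_le_int; apply: ltW; apply: le_lt_trans (floorD1_gt _).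
  exact: ler_wpM2l.
by move: fc; rewrite -lezD1; lra.
Qed.

(** * Branching and the substitution [x = U y] *)

Lemma KPR_mulmx (R : realType) n (a : 'rV[int]_n) (U : 'M[int]_n) u
    (b1 b2 : R) y : KPR a U u b1 b2 y <-> KP a u b1 b2 (toR R U *m y).
Proof. by rewrite /KPR/= dot_mulmx. Qed.

Lemma KP_image (R : realType) n (a : 'rV[int]_n) (U : 'M[int]_n) u
    (b1 b2 : R) : unimodular U ->
  KP a u b1 b2 = mulmx (toR R U) @` KPR a U u b1 b2.
Proof.
move=> /unimodular_unitmx U_unit; apply/seteqP; split=> x.
  move=> KPx; have Ux : toR R U *m (toR R (invmx U) *m x) = x.
    by rewrite mulmxA -toR_mulmx mulmxV// /toR map_mx1 mul1mx.
  by exists (toR R (invmx U) *m x) => //; apply/KPR_mulmx; rewrite Ux.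
by move=> [y /KPR_mulmx ? <-].
Qed.

(** If the first [k] entries of [p U] vanish, [p (U y)] is an integral
    combination of the coordinates of [y] from index [k] on. *)
Lemma infeasible_branching (R : realType) n (p a : 'rV[int]_n) U u
    (b1 b2 : R) k :
  (forall j : 'I_n, (j < k)%N -> (p *m U) 0 j = 0) ->
  infeasible_by_branching_on p (KP a u b1 b2) ->
  infeasible_by_branching_from k (KPR a U u b1 b2).
Proof.
move=> pU0 px_nint [y [/KPR_mulmx Qy y_int]].
have /negP := px_nint _ Qy; apply.
rewrite -dot_mulmx dotE; apply: rpred_sum => j _.
have [/pU0 ->|/y_int yj] := ltnP j k; first by rewrite mul0r rpred0.
by rewrite rpredM// intr_int.
Qed.

Lemma dot_e_last (R : realType) m (y : 'cV[R]_m.+1) :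
  dot (e_last m.+1) y = y ord_max 0.
Proof.
rewrite dotE (bigD1 ord_max)//= big1 => [|i /negbTE i_max].
  by rewrite mxE eqxx mul1r addr0.
by rewrite mxE eqSS -[RHS](mul0r (y i 0)) -[(i == m :> nat)]/(i == ord_max) i_max.
Qed.

Lemma dot_image_KP (R : realType) m (p a : 'rV[int]_m.+1) (U : 'M[int]_m.+1) u
    (b1 b2 : R) : unimodular U ->
  (forall j : 'I_m.+1, (j < m)%N -> (p *m U) 0 j = 0) ->
  dot p @` KP a u b1 b2 =
  [set ((p *m U) 0 ord_max)%:~R * t | t in dot (e_last _) @` KPR a U u b1 b2].
Proof.
move=> U_uni pU0; rewrite (KP_image _ _ _ _ U_uni) !image_comp.
apply: eq_imagel => y _ /=; rewrite -dot_mulmx dot_e_last dotE.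
rewrite (bigD1 ord_max)//= big1 ?addr0// => j j_max.
rewrite pU0 ?mul0r// ltn_neqAle -ltnS ltn_ord andbT.
by move: j_max; rewrite -val_eqE.
Qed.

(** For negative [q] the roles of supremum and infimum are exchanged, so that
    the scaling lemmas apply to [- S] and [|q|]. *)
Lemma width_scale (R : realType) n n' (q : int) (c : 'rV[int]_n) (c' : 'rV[int]_n')
    (P : set 'cV[R]_n) (Q : set 'cV[R]_n') : q != 0 ->
  dot c @` P = [set q%:~R * t | t in dot c' @` Q] ->
  width c P = `|q|%:~R * width c' Q /\
  (0 <= width c' Q -> iwidth c' Q <= iwidth c P).
Proof.
move=> q_neq0 cP; rewrite /iwidth /width /maxdot /mindot cP; set S := dot c' @` Q.
have q_ge1 : 1 <= `|q| by rewrite -gtz0_ge1 normr_gt0.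
have q_gt0 : 0 < `|q|%:~R :> R by rewrite ltr0z normr_gt0.
have [q0|q0] := lerP 0 q.
  have -> : [set q%:~R * t | t in S] = [set `|q|%:~R * t | t in S] by rewrite ger0_norm.
  rewrite sup_scale// inf_scale// mulrBr; split=> // S_ge0.
  by rewrite lerD2r floor_sub_ceil_scale// -subr_ge0.
have -> : [set q%:~R * t | t in S] = [set `|q|%:~R * t | t in [set - t | t in S]].
  rewrite image_comp; apply: eq_imagel => t _ /=.
  by rewrite ltr0_norm// rmorphN mulrNN.
rewrite sup_scale// inf_scale// supN infN -mulrBr.
have -> : - inf S - - sup S = sup S - inf S by rewrite [- - sup S]opprK addrC.
split=> //.
move=> S_ge0; rewrite lerD2r.
apply: le_trans (floor_sub_ceil_scale q_ge1 _); last by rewrite lerN2 -subr_ge0.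
have fN (x : R) : Num.floor (- x) = - Num.ceil x by rewrite ceilNfloor opprK.
have cN (x : R) : Num.ceil (- x) = - Num.floor x by rewrite floorNceil opprK.
by rewrite (fN (inf S)) (cN (sup S)) [- - Num.floor _]opprK addrC.
Qed.

(** * The width of (KP) *)

Lemma dot_le (R : realType) n (p a : 'rV[int]_n) (l : R) (x : 'cV[R]_n) :
  (forall i, 0 <= x i 0) -> (forall i, (p 0 i)%:~R <= l * (a 0 i)%:~R) ->
  dot p x <= l * dot a x.
Proof.
move=> x0 pla; rewrite !dotE mulr_sumr; apply: ler_sum => i _.
by rewrite mulrA ler_wpM2r.
Qed.

Lemma le_dot (R : realType) n (p a : 'rV[int]_n) (l : R) (x : 'cV[R]_n) :
  (forall i, 0 <= x i 0) -> (forall i, l * (a 0 i)%:~R <= (p 0 i)%:~R) ->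
  l * dot a x <= dot p x.
Proof.
move=> x0 pla; rewrite !dotE mulr_sumr; apply: ler_sum => i _.
by rewrite mulrA ler_wpM2r.
Qed.

(** The supremum and infimum are compared through a point of the set, which
    requires bounds: [p x >= 0], and [p x <= l (a x) <= l b2] with [l] the sum
    of the [p_i], since the [a_i] are integers at least 1. *)
Lemma width_KP_ge0 (R : realType) n (p a : 'rV[int]_n) u (b1 b2 : R) :
  (forall i, 0 < p 0 i) -> (forall i, 0 < a 0 i) -> 0 <= width p (KP a u b1 b2).
Proof.
move=> p_gt0 a_gt0; rewrite /width /maxdot /mindot; set S := dot p @` _.
have [->|/set0P[t St]] := eqVneq S set0; first by rewrite sup0 inf0 subrr.
pose l := \sum_i p 0 i.
have l_ge0 : 0 <= l by apply: sumr_ge0 => i _; exact: ltW.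
have lb : lbound S 0.
  move=> _ [x [_ x0] <-]; rewrite dotE; apply: sumr_ge0 => i _.
  by rewrite mulr_ge0 ?ler0z ?(ltW (p_gt0 i))//; have [] := x0 i.
have ub : ubound S (l%:~R * b2).
  move=> _ [x [/andP[_ ax] x0] <-]; apply: le_trans (_ : l%:~R * dot a x <= _).
    apply: dot_le => i; first by have [] := x0 i.
    rewrite -rmorphM/= ler_int; apply: (@le_trans _ _ l).
      by rewrite /l (bigD1 i)//= lerDl; apply: sumr_ge0 => j _; exact: ltW.
    by rewrite ler_peMr// -gtz0_ge1.
  by rewrite ler_wpM2l// ler0z.
rewrite subr_ge0; apply: (@le_trans _ _ t).
  by apply: ge_inf => //; exists 0.
by apply: ub_le_sup => //; exists (l%:~R * b2).
Qed.

Lemma KP_vertex (R : realType) n (p a : 'rV[int]_n) (b : R) i :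
  (forall i, 0 < a 0 i) -> 0 < b ->
  (dot p @` KP a (fun=> +oo%E) b b) (b * ((p 0 i)%:~R / (a 0 i)%:~R)).
Proof.
move=> a_gt0 b_gt0.
have ai : (a 0 i)%:~R != 0 :> R by rewrite intr_eq0 gt_eqF.
pose x : 'cV[R]_n := \col_j (b / (a 0 i)%:~R *+ (j == i)).
have cx c : dot c x = (c 0 i)%:~R * (b / (a 0 i)%:~R).
  rewrite dotE (bigD1 i)//= big1 => [|j /negbTE ji]; rewrite mxE ?ji ?mulr0//.
  by rewrite eqxx addr0.
exists x; last by rewrite cx; field.
split; first by rewrite cx mulrC divfK// lexx.
move=> j; rewrite leey; split=> //; rewrite mxE mulrn_wge0// divr_ge0 ?ltW//.
by rewrite ltr0z.
Qed.

(** On the simplex [a x = b], [x >= 0], the linear form [p] takes its extreme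
    values at the vertices [(b / a_i) e_i]. *)
Lemma width_KP_EQ (R : realType) n (p a : 'rV[int]_n) (b : R) i0 i1 :
  (forall i, 0 < a 0 i) -> 0 < b ->
  (forall i, (p 0 i1)%:~R / (a 0 i1)%:~R <= (p 0 i)%:~R / (a 0 i)%:~R :> R) ->
  (forall i, (p 0 i)%:~R / (a 0 i)%:~R <= (p 0 i0)%:~R / (a 0 i0)%:~R :> R) ->
  width p (KP a (fun=> +oo%E) b b) =
  b * ((p 0 i0)%:~R / (a 0 i0)%:~R - (p 0 i1)%:~R / (a 0 i1)%:~R).
Proof.
move=> a_gt0 b_gt0 min1 max0; rewrite mulrBr; congr (_ - _).
  apply: sup_attained; first exact: KP_vertex.
  move=> _ [x [/le_anti ax x0] <-]; rewrite ax mulrC; apply: dot_le => i.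
    by have [] := x0 i.
  by rewrite -ler_pdivrMr ?ltr0z//; exact: max0.
apply: inf_attained; first exact: KP_vertex.
move=> _ [x [/le_anti ax x0] <-]; rewrite ax mulrC; apply: le_dot => i.
  by have [] := x0 i.
by rewrite -ler_pdivlMr ?ltr0z//; exact: min1.
Qed.

(** From [p = (p U) U^-1], each [p_i] is the last entry of [p U] times an
    integer. *)
Lemma last_coord_bounds m (p : 'rV[int]_m.+1) (U : 'M[int]_m.+1) :
  (forall i, 0 < p 0 i) -> unimodular U ->
  (forall j : 'I_m.+1, (j < m)%N -> (p *m U) 0 j = 0) ->
  (p *m U) 0 ord_max != 0 /\ forall i, `|(p *m U) 0 ord_max| <= p 0 i.
Proof.
move=> p_gt0 /unimodular_unitmx U_unit pU0; set q := (p *m U) 0 ord_max.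
have pE i : p 0 i = q * invmx U ord_max i.
  rewrite -[p in LHS](mulmxK U_unit) mxE (bigD1 ord_max)//= big1 ?addr0// => j j_max.
  rewrite pU0 ?mul0r// ltn_neqAle -ltnS ltn_ord andbT.
  by move: j_max; rewrite -val_eqE.
split=> [|i].
  by apply/eqP => q0; have := p_gt0 ord0; rewrite pE q0 mul0r ltxx.
rewrite -[p 0 i]gtr0_norm ?p_gt0// pE normrM ler_peMr// -gtz0_ge1 normr_gt0.
by apply/eqP => Ui; have := p_gt0 i; rewrite pE Ui mulr0 ltxx.
Qed.

Lemma pU_eq0_last (R : realType) (reduced : reduction_method R) (c : R) m
    (p r : 'rV[int]_m.+1) (M : int) (U : 'M[int]_m.+1) :
  let a := M *: p + r in
  (forall i, 0 < p 0 i) ->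
  has_reduction_factor reduced m.+1 c -> unimodular U ->
  reduced (1 + m.+1)%N m.+1 (toR R (col_mx a 1%:M *m U)) ->
  c * (enorm (toR R r) + 1) ^+ 2 * enorm (toR R p) < M%:~R ->
  forall j : 'I_m.+1, (j < m)%N -> (p *m U) 0 j = 0.
Proof.
move=> a p_gt0 red_c U_uni B_red M_gt.
have [|D [D_indep pD0 D_le]] := @orthogonal_vectors R _ p m p_gt0.
  by rewrite subn1.
exact: pU_eq0_of_short_vectors red_c U_uni B_red (leqnSn m) D_indep pD0 D_le M_gt.
Qed.

Lemma width_KPR (R : realType) m (p a : 'rV[int]_m.+1) (U : 'M[int]_m.+1) u
    (b1 b2 : R) :
  (forall i, 0 < p 0 i) -> (forall i, 0 < a 0 i) -> unimodular U ->
  (forall j : 'I_m.+1, (j < m)%N -> (p *m U) 0 j = 0) ->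
  let Q := KPR a U u b1 b2 in let P := KP a u b1 b2 in
  [/\ width p P = `|(p *m U) 0 ord_max|%:~R * width (e_last m.+1) Q,
      0 <= width (e_last m.+1) Q &
      iwidth (e_last m.+1) Q <= iwidth p P].
Proof.
move=> p_gt0 a_gt0 U_uni pU0 Q P.
have [q_neq0 _] := last_coord_bounds p_gt0 U_uni pU0.
have [wP iwP] := width_scale q_neq0 (dot_image_KP a u b1 b2 U_uni pU0).
have w_ge0 : 0 <= width (e_last m.+1) Q.
  have := width_KP_ge0 u b1 b2 p_gt0 a_gt0.
  by rewrite wP pmulr_rge0// ltr0z normr_gt0.
by split=> //; exact: iwP.
Qed.

(** * Orders of magnitude *)

Lemma iwidth_width (R : realType) n (c : 'rV[int]_n) (Q : set 'cV[R]_n) :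
  width c Q - 1 <= (iwidth c Q)%:~R <= width c Q + 1.
Proof.
rewrite /iwidth /width rmorphD rmorphB /=.
have := floor_itv (maxdot c Q); have := ceil_itv (mindot c Q).
by rewrite rmorphB rmorphD/= => /andP[? ?] /andP[? ?]; lra.
Qed.

(** [x^-1 - y^-1] is [(y - x) / (x y)], and [x y] lies between [M^2 / 4] and
    [4 M^2]. *)
Lemma Theta_of_ratio_gap (R : realType) (M b x y : R) :
  0 < M -> 0 < b -> x <= y -> M / 2 <= x -> y <= 2 * M ->
  (y - x) / 4 * (b / M ^+ 2) <= b * (x^-1 - y^-1) <= 4 * (y - x) * (b / M ^+ 2).
Proof.
move=> M0 b0 xy Mx yM.
have x0 : 0 < x by lra.
have y0 : 0 < y by lra.
have -> : b * (x^-1 - y^-1) = (y - x) * (b / (x * y)).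
  by field; rewrite !gt_eqF.
have -> : (y - x) / 4 * (b / M ^+ 2) = (y - x) * (b / (4 * M ^+ 2)).
  by field; rewrite gt_eqF.
have -> : 4 * (y - x) * (b / M ^+ 2) = (y - x) * (b / (M ^+ 2 / 4)).
  by field; rewrite gt_eqF.
have mono (s t : R) : 0 < s -> s <= t -> (y - x) * (b / t) <= (y - x) * (b / s).
  move=> s0 st; rewrite ler_wpM2l ?subr_ge0// ler_wpM2l ?(ltW b0)//.
  by rewrite lef_pV2 ?posrE// (lt_le_trans s0).
by apply/andP; split; apply: mono; rewrite ?divr_gt0 ?mulr_gt0 ?exprn_gt0//; nra.
Qed.

(** Here [p_i / a_i = (M + rho_i)^-1] with [rho_i = r_i / p_i]. If the gap
    [rho_n - rho_1] were zero, all the [rho_i] would agree and [r] would be a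
    multiple of [p]; and [|rho_i| <= |r|] because [p_i >= 1]. *)
Lemma width_Theta (R : realType) m (p r : 'rV[int]_m.+1)
    (p_gt0 : forall i, 0 < p 0 i) : ~ parallel R p r ->
  (forall i j : 'I_m.+1, (i <= j)%N ->
    (r 0 i)%:~R / (p 0 i)%:~R <= (r 0 j)%:~R / (p 0 j)%:~R :> R) ->
  exists2 d : R, 0 < d & forall (M : int) (b : R), 0 < b ->
    (forall i, 0 < (M *: p + r) 0 i) ->
    2 * enorm (toR R r) <= M%:~R -> 0 < M%:~R :> R ->
    d / 4 * (b / M%:~R ^+ 2)
      <= width p (KP (M *: p + r) (fun=> +oo%E) b b) <= 4 * d * (b / M%:~R ^+ 2).
Proof.
move=> npar mono; pose rho i : R := (r 0 i)%:~R / (p 0 i)%:~R.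
have p0 i : (p 0 i)%:~R != 0 :> R by rewrite intr_eq0 gt_eqF.
have rho_min i : rho ord0 <= rho i by exact: mono.
have rho_max i : rho i <= rho ord_max by apply: mono; rewrite -ltnS.
exists (rho ord_max - rho ord0).
  rewrite subr_gt0 ltNge; apply/negP => rho_le; apply: npar.
  exists (rho ord0); right; apply/rowP => i; rewrite !mxE.
  have -> : rho ord0 = rho i.
    by apply/eqP; rewrite eq_le rho_min (le_trans (rho_max i)).
  by rewrite divfK.
move=> M b b_gt0 a_gt0 M_ge M_gt0; set a := M *: p + r.
have ratio i : (p 0 i)%:~R / (a 0 i)%:~R = (M%:~R + rho i)^-1 :> R.
  have -> : (a 0 i)%:~R = (p 0 i)%:~R * (M%:~R + rho i) :> R.
    by rewrite !mxE rmorphD rmorphM mulrDr [_ * rho i]mulrC divfK// mulrC.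
  by rewrite invfM mulrA divff// mul1r.
have rho_le i : `|rho i| <= M%:~R / 2.
  apply: (@le_trans _ _ (enorm (toR R r))); last by lra.
  apply: le_trans (norm_le_enorm _ 0 i); rewrite mxE normrM ler_piMr//.
  rewrite normfV invf_le1 ?normr_gt0// -intr_norm -[1]/(1%:~R) ler_int.
  by rewrite -gtz0_ge1 normr_gt0 gt_eqF.
have Mrho_gt0 i : M%:~R / 2 <= M%:~R + rho i <= 2 * M%:~R.
  by have := rho_le i; rewrite ler_norml => /andP[? ?]; apply/andP; split; lra.
have Mrho i : 0 < M%:~R + rho i by have /andP[? _] := Mrho_gt0 i; lra.
rewrite (@width_KP_EQ _ _ _ _ _ ord0 ord_max)// => [|i|i]; rewrite !ratio; last 2 first.
- by rewrite lef_pV2 ?posrE// lerD2l.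
- by rewrite lef_pV2 ?posrE// lerD2l.
have -> : rho ord_max - rho ord0 = (M%:~R + rho ord_max) - (M%:~R + rho ord0).
  by ring.
have /andP[x1 x2] := Mrho_gt0 ord0; have /andP[y1 y2] := Mrho_gt0 ord_max.
by apply: Theta_of_ratio_gap => //; rewrite lerD2l.
Qed.

Lemma pU_eq0_alpha (R : realType) (reduced : reduction_method R) (c : R) n k
    (p r : 'rV[int]_n) (M : int) (U : 'M[int]_n) :
  let a := M *: p + r in
  (forall i, 0 < p 0 i) ->
  has_reduction_factor reduced n c -> unimodular U ->
  reduced (1 + n)%N n (toR R (col_mx a 1%:M *m U)) -> (k <= n - 1)%N ->
  c * (enorm (toR R r) + 1) ^+ 2 * alpha R p k < M%:~R ->
  forall j : 'I_n, (j < k)%N -> (p *m U) 0 j = 0.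
Proof.
move=> a p_gt0 red_c U_uni B_red kn M_gt j j_lt_k.
have n_gt0 : (0 < n)%N by case: j {j_lt_k} => ? /ltn_predK <-.
have c_ge1 := reduction_factor_ge1 red_c (lin_indep_stackU R a U_uni) B_red n_gt0.
set K := c * _ in M_gt.
have K_gt0 : 0 < K.
  by rewrite mulr_gt0 ?exprn_gt0 ?(lt_le_trans ltr01)// lerDr enorm_ge0.
have [|D [t [D_indep pD0 D_le t_lt]]] := @alpha_lt R _ p k (M%:~R / K) p_gt0 kn.
  by rewrite ltr_pdivlMr// mulrC.
apply: pU_eq0_of_short_vectors red_c U_uni B_red _ D_indep pD0 D_le _ j j_lt_k.
  exact: leq_trans kn (leq_subr _ _).
by rewrite mulrC -ltr_pdivlMr.
Qed.

(** With [d] the gap of the ratios [r_i / p_i], the width lies between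
    [d s / (4 p_1)] and [4 d s]. For [s >= 8 p_1 / d], the possible error of 1
    in the integer width is at most [d s / (8 p_1)]: this is why the lower
    constant is half of what the width alone allows, and the upper one
    [5 d]. *)
Lemma width_KPR_EQ_Theta (R : realType) m (p r : 'rV[int]_m.+1) :
  (forall i, 0 < p 0 i) -> ~ parallel R p r ->
  (forall i j : 'I_m.+1, (i <= j)%N ->
     (r 0 i)%:~R / (p 0 i)%:~R <= (r 0 j)%:~R / (p 0 j)%:~R :> R) ->
  exists C1 C2 T : R, 0 < C1 /\ 0 < C2 /\
  forall (reduced : reduction_method R) (c : R) (M : int) (b : R)
      (U : 'M[int]_m.+1),
    let a := M *: p + r in
    let Q := KPR a U (fun=> +oo%E) b b in
    let s := b / M%:~R ^+ 2 in
    has_reduction_factor reduced m.+1 c ->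
    (forall i, 0 < a 0 i) ->
    0 < b ->
    unimodular U ->
    reduced (1 + m.+1)%N m.+1 (toR R (col_mx a 1%:M *m U)) ->
    c * (enorm (toR R r) + 1) ^+ 2 * enorm (toR R p) < M%:~R ->
    (C1 * s <= width (e_last m.+1) Q <= C2 * s) /\
    (T <= s -> C1 * s <= (iwidth (e_last m.+1) Q)%:~R <= C2 * s).
Proof.
move=> p_gt0 npar mono.
have [d d_gt0 width_le] := width_Theta p_gt0 npar mono.
set p1 : R := (p 0 ord0)%:~R.
have p1_ge1 : 1 <= p1 by rewrite -[1]/(1%:~R) ler_int -gtz0_ge1.
have p1_gt0 : 0 < p1 by lra.
exists (d / (8 * p1)), (5 * d), (8 * p1 / d); split; first by rewrite divr_gt0 ?mulr_gt0.
split=> [|reduced c M b U a Q s red_c a_gt0 b_gt0 U_uni B_red M_gt]; first by lra.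
have c_ge1 := reduction_factor_ge1 red_c (lin_indep_stackU R a U_uni) B_red isT.
have r_ge0 := enorm_ge0 (toR R r).
have p_ge1 : 1 <= enorm (toR R p).
  apply: le_trans (norm_le_enorm _ 0 ord0); rewrite mxE.
  by rewrite (le_trans p1_ge1)// ler_norm.
(* This makes [M] at least [2 |r|], since [(x + 1)^2 >= 2 x]. *)
have M_gt_r : (enorm (toR R r) + 1) ^+ 2 < M%:~R.
  apply: le_lt_trans M_gt; rewrite -mulrA mulrCA ler_peMr ?sqr_ge0//.
  by rewrite -[1]mulr1 ler_pM.
have M_gt0 : 0 < M%:~R :> R by nra.
have pU0 := pU_eq0_last p_gt0 red_c U_uni B_red M_gt.
have [wP w_ge0 _] := width_KPR (fun=> +oo%E) b b p_gt0 a_gt0 U_uni pU0.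
have [q_neq0 /(_ ord0) q_le] := last_coord_bounds p_gt0 U_uni pU0.
have M_ge_2r : 2 * enorm (toR R r) <= M%:~R by nra.
have := width_le M b b_gt0 a_gt0 M_ge_2r M_gt0; rewrite -/a -/s wP -/Q.
set q : R := `|_|%:~R; set w := width _ Q in w_ge0 wP *.
have q_ge1 : 1 <= q by rewrite -[1]/(1%:~R) ler_int -gtz0_ge1 normr_gt0.
have {}q_le : q <= p1 by rewrite ler_int.
move=> /andP[qw_ge qw_le].
have s_gt0 : 0 < s by rewrite divr_gt0 ?exprn_gt0.
have -> : d / (8 * p1) * s = d * s / 8 / p1 by field; rewrite gt_eqF.
set e := d * s / 8 / p1.
have eE : e * p1 = d * s / 8 by rewrite divfK ?gt_eqF.
have e_gt0 : 0 < e by apply: divr_gt0 => //; apply: divr_gt0 => //; exact: mulr_gt0.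
have w_ge : 2 * e <= w.
  by rewrite -(ler_pM2r p1_gt0); nra.
have w_le : w <= 4 * (d * s) by nra.
split=> [|T_le]; first by apply/andP; split; nra.
have e_ge1 : 1 <= e.
  rewrite /e ler_pdivlMr// ler_pdivlMr// mul1r.
  by move: T_le; rewrite ler_pdivrMr// => T_le; lra.
have ds_ge : e <= d * s / 8 by nra.
have /andP[iw1 iw2] := iwidth_width (e_last m.+1) Q.
by apply/andP; split; rewrite -/w in iw1 iw2; lra.
Qed.

Theorem theorem10 (R : realType) (n : nat) (p r : 'rV[int]_n)
    (p_gt0 : forall i, 0 < p 0 i) :
  (forall (reduced : reduction_method R) (c : R) (M : int)
      (u : 'I_n -> \bar R) (b1 b2 : R) (U : 'M[int]_n),
    let a := M *: p + r in
    has_reduction_factor reduced n c ->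
    (forall i, 0 < a 0 i) ->
    (forall i, u i = +oo%E \/
       exists2 m : nat, (0 < m)%N & u i = (m%:R : R)%:E) ->
    0 < b1 -> b1 <= b2 ->
    (b2%:E < \sum_i ((a 0 i)%:~R : R)%:E * u i)%E ->
    unimodular U ->
    reduced (1 + n)%N n (toR R (col_mx a 1%:M *m U)) ->
    (forall k : nat, (1 <= k)%N -> (k <= n - 1)%N ->
       c * (enorm (toR R r) + 1) ^+ 2 * alpha R p k < M%:~R ->
       (forall j : 'I_n, (j < k)%N -> (p *m U) 0 j = 0) /\
       (infeasible_by_branching_on p (KP a u b1 b2) ->
        infeasible_by_branching_from k (KPR a U u b1 b2))) /\
    (c * (enorm (toR R r) + 1) ^+ 2 * enorm (toR R p) < M%:~R ->
       (forall j : 'I_n, (j < n - 1)%N -> (p *m U) 0 j = 0) /\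
       width (e_last n) (KPR a U u b1 b2) <= width p (KP a u b1 b2) /\
       iwidth (e_last n) (KPR a U u b1 b2) <= iwidth p (KP a u b1 b2)))
  /\
  (~ parallel R p r ->
   (forall i j : 'I_n, (i <= j)%N ->
      (r 0 i)%:~R / (p 0 i)%:~R <= (r 0 j)%:~R / (p 0 j)%:~R :> R) ->
   exists C1 C2 T : R, 0 < C1 /\ 0 < C2 /\
   forall (reduced : reduction_method R) (c : R) (M : int) (b : R)
      (U : 'M[int]_n),
    let a := M *: p + r in
    let Q := KPR a U (fun=> +oo%E) b b in
    let s := b / M%:~R ^+ 2 in
    has_reduction_factor reduced n c ->
    (forall i, 0 < a 0 i) ->
    0 < b ->
    unimodular U ->
    reduced (1 + n)%N n (toR R (col_mx a 1%:M *m U)) ->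
    c * (enorm (toR R r) + 1) ^+ 2 * enorm (toR R p) < M%:~R ->
    (C1 * s <= width (e_last n) Q <= C2 * s) /\
    (T <= s -> C1 * s <= (iwidth (e_last n) Q)%:~R <= C2 * s)).
Proof.
case: n p r p_gt0 => [|m] p r p_gt0; split; last first.
- exact: width_KPR_EQ_Theta.
- move=> reduced c M u b1 b2 U a red_c a_gt0 _ _ _ _ U_uni B_red.
  split=> [k _ kn M_gt|M_gt].
    have pU0 := pU_eq0_alpha p_gt0 red_c U_uni B_red kn M_gt.
    by split=> //; exact: infeasible_branching.
  have pU0 := pU_eq0_last p_gt0 red_c U_uni B_red M_gt.
  have [-> w_ge0 iw_le] := width_KPR u b1 b2 p_gt0 a_gt0 U_uni pU0.
  split; first by rewrite subn1.
  split=> //; rewrite ler_peMl// -[1]/(1%:~R) ler_int -gtz0_ge1 normr_gt0.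
  by have [] := last_coord_bounds p_gt0 U_uni pU0.
(* In dimension 0 all vectors are parallel. *)
- by case; exists 0; left; apply/rowP => -[].
(* In dimension 0 the upper bound on [b2] reads [b2 < 0]. *)
- move=> reduced c M u b1 b2 U a _ _ _ b1_gt0 b12.
  by rewrite big_ord0 lte_fin ltNge (le_trans (ltW b1_gt0)).
Qed.
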